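(* Let $m,n,\alpha\in\mathbb{N}$. Then the function $f_{m,n,\alpha}:\mathbf{Nil}\to\mathbb{R}$ given by $$f_{m,n,\alpha}(x,y,t)=x^m\cdot y^{n}\cdot t^{\alpha}$$ (1) is $(\lfloor (m+\alpha)/2\rfloor+\lfloor n/2\rfloor+1+\lfloor \alpha/2\rfloor)$-harmonic if $\alpha$ is even; (2) is $(\lfloor (m+\alpha)/2\rfloor+\lfloor (n+1)/2\rfloor+1+\lfloor \alpha/2\rfloor)$-harmonic if $\alpha$ is odd.
   Context: $\mathbb{N}$ denotes the natural numbers including $0$. $\mathbf{Nil}$ is the Riemannian manifold $\mathbb{R}^3$ with global coordinates $(x,y,t)$ and metric $ds^2=dx^2+dy^2+(dt-x\,dy)^2$. Its Laplace-Beltrami operator, acting on smooth complex-valued functions, is $$\tau(f)=\frac{\partial^2 f}{\partial x^2}+\frac{\partial^2 f}{\partial y^2}+2x\,\frac{\partial^2 f}{\partial y\partial t}+(1+x^2)\,\frac{\partial^2 f}{\partial t^2}.$$ Put $\tau^0(f)=f$ and $\tau^r(f)=\tau(\tau^{r-1}(f))$. For $r\ge1$, a smooth function $f$ is $r$-harmonic if $\tau^r(f)=0$ identically. *)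

(* Defs.v *)
From Stdlib Require Import Reals Arith.
From Coquelicot Require Import Coquelicot.
Open Scope R_scope.

(* Only the global coordinates (x, y, t) of Nil matter here; the metric
   dx^2 + dy^2 + (dt - x dy)^2 enters through its Laplace-Beltrami operator
   [tau] below. *)
Definition Nil : Type := (R * R * R)%type.

Inductive coord : Set := cx | cy | ct.

Definition coord_of (i : coord) (p : Nil) : R :=
  let '(x, y, t) := p in
  match i with cx => x | cy => y | ct => t end.

Definition set_coord (i : coord) (p : Nil) (s : R) : Nil :=
  let '(x, y, t) := p in
  match i with cx => (s, y, t) | cy => (x, s, t) | ct => (x, y, s) end.

(* Coquelicot's total [Derive] is real-valued, so the partial derivative of a
   complex-valued function is taken on real and imaginary parts.  It is only
   meaningful where the function is differentiable, which [smooth] ensures. *)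
Definition partial (i : coord) (f : Nil -> C) : Nil -> C := fun p =>
  (Derive (fun s => Re (f (set_coord i p s))) (coord_of i p),
   Derive (fun s => Im (f (set_coord i p s))) (coord_of i p)).

Definition has_partial (i : coord) (f : Nil -> C) : Prop := forall p : Nil,
  @ex_derive R_AbsRing C_R_NormedModule
    (fun s => f (set_coord i p s)) (coord_of i p).

Definition continuous_on_Nil (f : Nil -> C) : Prop := forall p : Nil,
  @continuous
    (prod_UniformSpace (prod_UniformSpace R_UniformSpace R_UniformSpace)
       R_UniformSpace)
    C_UniformSpace f p.

Fixpoint C_class (k : nat) (f : Nil -> C) : Prop :=
  match k with
  | O => continuous_on_Nil f
  | S k' => forall i : coord, has_partial i f /\ C_class k' (partial i f)
  end.

Definition smooth (f : Nil -> C) : Prop := forall k : nat, C_class k f.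

Definition tau (f : Nil -> C) : Nil -> C := fun p =>
  let x := coord_of cx p in
  (partial cx (partial cx f) p
   + partial cy (partial cy f) p
   + RtoC (2 * x) * partial cy (partial ct f) p
   + RtoC (1 + x ^ 2) * partial ct (partial ct f) p)%C.

Fixpoint tau_iter (r : nat) (f : Nil -> C) : Nil -> C :=
  match r with
  | O => f
  | S r' => tau (tau_iter r' f)
  end.

Definition r_harmonic (r : nat) (f : Nil -> C) : Prop :=
  (1 <= r)%nat /\ smooth f /\ forall p : Nil, tau_iter r f p = RtoC 0.

Definition monomial (m n alpha : nat) : Nil -> R := fun p =>
  let '(x, y, t) := p in x ^ m * y ^ n * t ^ alpha.

(* Main.v *)
(** Apply [tau] to [x^m y^n t^a]: it yields a combination of the monomials with
    exponents (m-2,n,a), (m,n-2,a), (m+1,n-1,a-1), (m,n,a-2) and (m+2,n,a-2).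
    The weight floor((m+a)/2) + floor((n + (a mod 2))/2) + floor(a/2) strictly
    decreases in each of the five cases in which the coefficient is nonzero, so
    one more application of [tau] than the weight gives zero. *)
Require Import Defs.
From Stdlib Require Import Reals Arith.
From Coquelicot Require Import Coquelicot.
From Stdlib Require Import List ZArith ZifyNat Lia FunctionalExtensionality.
Import ListNotations.
Open Scope R_scope.

(** Polynomials stay unnormalised: in a list of terms monomials may repeat and coefficients may
    vanish, so each differential operator acts by [map]. *)
Record term : Type :=
  Term { coef : R; deg_x : nat; deg_y : nat; deg_t : nat }.

Definition eval_term (u : term) (p : Nil) : R :=
  coef u * monomial (deg_x u) (deg_y u) (deg_t u) p.

Fixpoint eval (l : list term) (p : Nil) : R :=
  match l with
  | [] => 0
  | u :: l' => eval_term u p + eval l' p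
  end.

(** Truncation [pred 0 = 0] is harmless, since the factor [INR 0] then kills the coefficient. *)
Definition diff_term (i : coord) (u : term) : term :=
  let '(Term c m n a) := u in
  match i with
  | cx => Term (c * INR m) (pred m) n a
  | cy => Term (c * INR n) m (pred n) a
  | ct => Term (c * INR a) m n (pred a)
  end.

Definition mul_x (c : R) (k : nat) (u : term) : term :=
  Term (c * coef u) (k + deg_x u) (deg_y u) (deg_t u).

(** The factor [1 + x ^ 2] is split into two blocks so that each block sends one monomial to one
    monomial. *)
Definition tau_terms (l : list term) : list term :=
  map (fun u => diff_term cx (diff_term cx u)) l ++
  map (fun u => diff_term cy (diff_term cy u)) l ++
  map (fun u => mul_x 2 1 (diff_term cy (diff_term ct u))) l ++
  map (fun u => diff_term ct (diff_term ct u)) l ++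
  map (fun u => mul_x 1 2 (diff_term ct (diff_term ct u))) l.

Lemma eval_app (l l' : list term) (p : Nil) :
  eval (l ++ l') p = eval l p + eval l' p.
Proof. induction l as [|u l IH]; simpl; [|rewrite IH]; ring. Qed.

Lemma eval_mul_x (c : R) (k : nat) (l : list term) (p : Nil) :
  eval (map (mul_x c k) l) p = c * coord_of cx p ^ k * eval l p.
Proof.
  induction l as [|u l IH]; simpl; [ring|].
  rewrite IH.
  destruct p as [[x y] t]; unfold eval_term; simpl.
  rewrite pow_add; ring.
Qed.

Lemma is_derive_eval_term (i : coord) (u : term) (p : Nil) :
  is_derive (fun s => eval_term u (set_coord i p s)) (coord_of i p)
    (eval_term (diff_term i u) p).
Proof.
  destruct u as [c m n a], p as [[x y] t].
  destruct i; unfold eval_term; simpl; auto_derive; trivial; ring.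
Qed.

Lemma is_derive_eval (i : coord) (l : list term) (p : Nil) :
  is_derive (fun s => eval l (set_coord i p s)) (coord_of i p)
    (eval (map (diff_term i) l) p).
Proof.
  induction l as [|u l IH]; simpl.
  - apply @is_derive_const.
  - apply @is_derive_plus; [apply is_derive_eval_term | exact IH].
Qed.

(** An equality of functions, so that it rewrites inside a further [partial]. *)
Lemma partial_eval (i : coord) (l : list term) :
  partial i (fun p => RtoC (eval l p)) =
  (fun p => RtoC (eval (map (diff_term i) l) p)).
Proof.
  apply functional_extensionality; intro p.
  unfold partial, RtoC; simpl; f_equal.
  - apply is_derive_unique, is_derive_eval.
  - apply Derive_const.
Qed.

Lemma has_partial_eval (i : coord) (l : list term) :
  has_partial i (fun p => RtoC (eval l p)).
Proof.
  intro p.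
  (* A real function is viewed as a scalar multiple of the fixed vector 1 of the real normed space
     [C]. *)
  apply ex_derive_ext with
    (fun s => @scal R_Ring C_R_NormedModule (eval l (set_coord i p s)) (RtoC 1)).
  - intro s; rewrite scal_R_Cmult; apply Cmult_1_r.
  - eexists; apply @is_derive_scal_l, is_derive_eval.
Qed.

Lemma continuous_pow {U : UniformSpace} (f : U -> R) (k : nat) (p : U) :
  continuous f p -> continuous (fun q => f q ^ k) p.
Proof.
  intro Hf; induction k as [|k IH]; simpl.
  - apply continuous_const.
  - now apply (continuous_mult f (fun q => f q ^ k)).
Qed.

Definition Nil_UniformSpace : UniformSpace :=
  prod_UniformSpace (prod_UniformSpace R_UniformSpace R_UniformSpace)
    R_UniformSpace.

Lemma continuous_monomial (m n a : nat) (p : Nil_UniformSpace) :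
  continuous (monomial m n a : Nil_UniformSpace -> R) p.
Proof.
  apply continuous_ext with
    (fun q : Nil_UniformSpace => fst (fst q) ^ m * snd (fst q) ^ n * snd q ^ a).
  - now intros [[x y] t].
  - apply (continuous_mult (fun q => fst (fst q) ^ m * snd (fst q) ^ n)
      (fun q => snd q ^ a)); [apply (continuous_mult (fun q => fst (fst q) ^ m)
        (fun q => snd (fst q) ^ n))|]; apply continuous_pow.
    + apply (continuous_comp fst fst); apply continuous_fst.
    + apply (continuous_comp fst snd); [apply continuous_fst | apply continuous_snd].
    + apply continuous_snd.
Qed.

Lemma continuous_eval (l : list term) (p : Nil_UniformSpace) :
  continuous (eval l : Nil_UniformSpace -> R) p.
Proof.
  induction l as [|u l IH]; simpl.
  - apply continuous_const.
  - apply @continuous_plus; [|exact IH].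
    apply @continuous_mult; [apply continuous_const | apply continuous_monomial].
Qed.

Lemma continuous_RtoC_comp {U : UniformSpace} (f : U -> R) (p : U) :
  continuous f p -> @continuous U C_UniformSpace (fun q => RtoC (f q)) p.
Proof.
  intros Hf.
  apply filterlim_locally; intro eps.
  generalize (proj1 (filterlim_locally _ _) Hf eps).
  apply filter_imp; intros q Hq; split; [exact Hq | apply ball_center].
Qed.

(** Polynomials are continuous and closed under [partial], so induction on the class works for all
    [l] at once. *)
Lemma smooth_eval (l : list term) : smooth (fun p => RtoC (eval l p)).
Proof.
  intro k; revert l; induction k as [|k IH]; intro l; simpl.
  - intro p; apply (@continuous_RtoC_comp Nil_UniformSpace), continuous_eval.
  - intro i; split; [apply has_partial_eval|].
    rewrite partial_eval; apply IH.
Qed.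

Lemma tau_eval (l : list term) :
  tau (fun p => RtoC (eval l p)) = (fun p => RtoC (eval (tau_terms l) p)).
Proof.
  apply functional_extensionality; intro p.
  unfold tau, tau_terms.
  rewrite !partial_eval, !map_map, !eval_app.
  rewrite <- (map_map (fun u => diff_term cy (diff_term ct u)) (mul_x 2 1)).
  rewrite <- (map_map (fun u => diff_term ct (diff_term ct u)) (mul_x 1 2)).
  rewrite !eval_mul_x, <- !RtoC_mult, <- !RtoC_plus.
  f_equal; ring.
Qed.

(** The summand [a mod 2] merges the even and odd cases of the theorem into one formula. *)
Definition weight (m n a : nat) : nat :=
  ((m + a) / 2 + (n + a mod 2) / 2 + a / 2)%nat.

(** The first alternative covers terms killed by differentiation, whose truncated exponents need not
    have smaller weight. *)
Definition light (k : nat) (u : term) : Prop :=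
  coef u = 0 \/ (weight (deg_x u) (deg_y u) (deg_t u) < k)%nat.

Lemma eval_light_0 (l : list term) (p : Nil) :
  Forall (light 0) l -> eval l p = 0.
Proof.
  induction 1 as [|u l Hu _ IH]; simpl; [reflexivity|].
  rewrite IH; unfold eval_term.
  destruct Hu as [-> | Hu]; [ring | lia].
Qed.

Ltac Zify.zify_post_hook ::= Z.to_euclidean_division_equations.

Lemma weight_SS_x (m n a : nat) : weight (S (S m)) n a = S (weight m n a).
Proof. unfold weight; lia. Qed.

Lemma weight_SS_y (m n a : nat) : weight m (S (S n)) a = S (weight m n a).
Proof. unfold weight; lia. Qed.

Lemma weight_SS_t (m n a : nat) : weight m n (S (S a)) = S (S (weight m n a)).
Proof. unfold weight; lia. Qed.

(** The sum [m + a] is balanced. The extra unit comes from the [y] summand if [a] is even, and from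
    [a / 2] if [a] is odd. *)
Lemma weight_S_yt (m n a : nat) : weight m (S n) (S a) = S (weight (S m) n a).
Proof. unfold weight; lia. Qed.

Lemma tau_terms_light (k : nat) (l : list term) :
  Forall (light (S k)) l -> Forall (light k) (tau_terms l).
Proof.
  intro H; unfold tau_terms; rewrite !Forall_app, !Forall_map.
  repeat split; revert H; apply Forall_impl; intros [c m n a] [Hu | Hu];
    unfold light; simpl in *; try (left; rewrite Hu; ring).
  (* One goal per block of [tau_terms]: exponents too small for the derivatives give coefficient 0,
     the others a lower weight. *)
  - destruct m as [|[|m]]; [left; simpl; ring .. |].
    right; rewrite weight_SS_x in Hu; simpl; lia.
  - destruct n as [|[|n]]; [left; simpl; ring .. |].
    right; rewrite weight_SS_y in Hu; simpl; lia.
  - destruct a as [|a]; [left; simpl; ring|].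
    destruct n as [|n]; [left; simpl; ring|].
    right; rewrite weight_S_yt in Hu; simpl; lia.
  - destruct a as [|[|a]]; [left; simpl; ring .. |].
    right; rewrite weight_SS_t in Hu; simpl; lia.
  - destruct a as [|[|a]]; [left; simpl; ring .. |].
    (* Two [t]-derivatives lower the weight by 2 and the factor [x ^ 2] restores 1. *)
    right; rewrite weight_SS_t in Hu; simpl pred; rewrite weight_SS_x; lia.
Qed.

(** The induction on weight must apply [tau] to the list first, whereas [tau_iter] unfolds from the
    outside. *)
Lemma tau_iter_S_inner (r : nat) (f : Nil -> C) :
  tau_iter (S r) f = tau_iter r (tau f).
Proof. induction r as [|r IH]; simpl in *; [reflexivity | now rewrite IH]. Qed.

Lemma tau_iter_light (k : nat) (l : list term) (p : Nil) :
  Forall (light k) l -> tau_iter k (fun q => RtoC (eval l q)) p = RtoC 0.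
Proof.
  revert l; induction k as [|k IH]; intros l Hl.
  - simpl; now rewrite eval_light_0.
  - rewrite tau_iter_S_inner, tau_eval.
    now apply IH, tau_terms_light.
Qed.

Lemma r_harmonic_monomial (m n a : nat) :
  r_harmonic (S (weight m n a)) (fun p => RtoC (monomial m n a p)).
Proof.
  replace (fun p => RtoC (monomial m n a p))
    with (fun p => RtoC (eval [Term 1 m n a] p)).
  - split; [lia | split; [apply smooth_eval|]].
    intro p; apply tau_iter_light.
    constructor; [right; simpl; lia | constructor].
  - apply functional_extensionality; intro p.
    unfold eval, eval_term; simpl; f_equal; ring.
Qed.

Theorem theorem1p3 (m n alpha : nat) :
  (Nat.Even alpha ->
    r_harmonic ((m + alpha) / 2 + n / 2 + 1 + alpha / 2)%nat
      (fun p : Nil => RtoC (monomial m n alpha p))) /\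
  (Nat.Odd alpha ->
    r_harmonic ((m + alpha) / 2 + (n + 1) / 2 + 1 + alpha / 2)%nat
      (fun p : Nil => RtoC (monomial m n alpha p))).
Proof.
  (* The parity witness fixes [alpha mod 2], so both stated orders equal [S (weight m n alpha)]. *)
  split; intros [k Hk];
    [ replace ((m + alpha) / 2 + n / 2 + 1 + alpha / 2)%nat
        with (S (weight m n alpha)) by (unfold weight; lia)
    | replace ((m + alpha) / 2 + (n + 1) / 2 + 1 + alpha / 2)%nat
        with (S (weight m n alpha)) by (unfold weight; lia) ];
    apply r_harmonic_monomial.
Qed.
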